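(* Let $m\ge 2$, $n\ge 1$, let $\mathcal M=(m_{i_1i_2\ldots i_m})$ be an $m$th-order $n$-dimensional real tensor that is a strong M-tensor, let $b\in\mathbb R^n$, let $M=(m_{ij})\in\mathbb R^{n\times n}$ be the majorization matrix of $\mathcal M$, i.e. $m_{ij}=m_{ij\ldots j}$, and let $\mathcal S=\{x\in\mathbb R^n_+ : \mathcal M x^{m-1}\le b\}$. Consider the equation $\mathcal M x^{m-1}=b$. Then: (i) The equation $\mathcal M x^{m-1}=b$ has a nonnegative solution if and only if $\mathcal S\neq\emptyset$. If $\mathcal S\ne\emptyset$, then the largest element of $\mathcal S$ is the largest nonnegative solution of the equation. In particular, if $M^{-1}b\ge 0$, then the equation has a nonnegative solution. (ii) The equation $\mathcal M x^{m-1}=b$ has a positive solution if and only if $\mathcal S$ contains a positive element (a vector all of whose entries are positive). In particular, if $M^{-1}b>0$, then the equation has a positive solution.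
   Context: For an $m$th-order $n$-dimensional real tensor $\mathcal A=(a_{i_1\ldots i_m})$ (all indices in $\{1,\dots,n\}$) and a vector $x$, $\mathcal A x^{m-1}$ is the vector with entries $(\mathcal A x^{m-1})_i=\sum_{i_2,\ldots,i_m=1}^n a_{ii_2\ldots i_m}x_{i_2}\cdots x_{i_m}$. An eigenvalue of $\mathcal A$ is $\lambda\in\mathbb C$ such that $\mathcal A x^{m-1}=\lambda x^{[m-1]}$ for some nonzero $x\in\mathbb C^n$, where $x^{[k]}=(x_1^k,\dots,x_n^k)^T$. The spectral radius is $\rho(\mathcal A)=\max\{|\lambda| : \lambda \text{ an eigenvalue of }\mathcal A\}$. The identity tensor $\mathcal I$ has diagonal entries $1$ and all other entries $0$. A tensor $\mathcal M$ is a strong M-tensor if $\mathcal M=s\mathcal I-\mathcal B$ with $s>0$, $\mathcal B$ entrywise nonnegative, and $s>\rho(\mathcal B)$. The majorization matrix of a strong M-tensor is a nonsingular M-matrix, so $M^{-1}$ exists. Vector inequalities ($\ge$, $\le$, $>$) are componentwise. The largest element of a set $T\subseteq\mathbb R^n$ is an element $\bar x\in T$ with $x\le\bar x$ for all $x\in T$; the largest nonnegative solution is the largest element of the set of nonnegative solutions. *)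

(* Defs.v *)
From mathcomp Require Export all_boot all_order all_algebra.
From mathcomp Require Export classical_sets reals.
From mathcomp Require Export complex.

Set Implicit Arguments.
Unset Strict Implicit.
Unset Printing Implicit Defensive.

Import Order.TTheory GRing.Theory Num.Theory.
Local Open Scope ring_scope.
Local Open Scope classical_set_scope.
Local Open Scope complex_scope.

(* The entry a_(i_1 ... i_m) of A is A [tuple i_1; ...; i_m]. *)
Definition tensor (K : Type) (m n : nat) := m.-tuple 'I_n -> K.

(* (A x^(m-1))_i : the sum is over the index tuples (i_1, ..., i_m) with
   i_1 = i, and the product over the remaining indices i_2, ..., i_m. *)
Definition tensor_apply (K : comNzRingType) (m n : nat)
    (A : tensor K m n) (x : 'cV[K]_n) : 'cV[K]_n :=
  \col_i \sum_(t : m.-tuple 'I_n | ohead t == Some i)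
    A t * \prod_(j <- behead t) x j 0.

Definition vec_pow (K : comNzRingType) (n k : nat) (x : 'cV[K]_n) : 'cV[K]_n :=
  \col_i (x i 0 ^+ k).

(* [constant t] : all the indices in t are equal. *)
Definition tensor_id (K : comNzRingType) (m n : nat) : tensor K m n :=
  fun t => (constant t)%:R.

Section RealTensors.
Variables (R : realType) (m n : nat).
Implicit Types (A B M : tensor R m n) (x y b : 'cV[R]_n).

Definition tensor_eigenvalue A (l : R[i]) : Prop :=
  exists2 z : 'cV[R[i]]_n, z != 0 &
    tensor_apply (fun t => (A t)%:C) z = l *: vec_pow m.-1 z.

(* r is the maximum of the set of the moduli of the eigenvalues of A; the
   norm of R[i] takes its values in R[i], hence the embeddings of r. *)
Definition is_spectral_radius A (r : R) : Prop :=
  (exists2 l, tensor_eigenvalue A l & `|l| = r%:C) /\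
  (forall l, tensor_eigenvalue A l -> `|l| <= r%:C).

Definition strong_M_tensor M : Prop :=
  exists (s : R) (B : tensor R m n) (r : R),
    [/\ 0 < s,
        forall t, 0 <= B t,
        forall t, M t = s * tensor_id R t - B t,
        is_spectral_radius B r &
        r < s].

(* m_ij = m_(i j ... j) *)
Definition majorization_mx M : 'M[R]_n :=
  \matrix_(i, j) M [tuple (if k == 0%N :> nat then i else j) | k < m].

Definition vec_le x y : Prop := forall i, x i 0 <= y i 0.
Definition vec_nonneg x : Prop := vec_le 0 x.
Definition vec_pos x : Prop := forall i, 0 < x i 0.

Definition is_largest (T : set 'cV[R]_n) x : Prop :=
  T x /\ forall y, T y -> vec_le y x.

Definition sub_solutions M b : set 'cV[R]_n :=
  [set x | vec_nonneg x /\ vec_le (tensor_apply M x) b].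

Definition nonneg_solutions M b : set 'cV[R]_n :=
  [set x | vec_nonneg x /\ tensor_apply M x = b].

Definition pos_solutions M b : set 'cV[R]_n :=
  [set x | vec_pos x /\ tensor_apply M x = b].

End RealTensors.

(* Main.v *)
(* Write the tensor as [s I - B].  If some [w > 0] satisfies
   [B w^(m-1) < s w^[m-1]], then the set of nonnegative subsolutions is
   bounded, and by monotonicity of [B] its componentwise supremum is a
   subsolution, indeed a solution.  Such a [w] exists because [s] exceeds the
   spectral radius: otherwise the least [c] beyond which these vectors exist
   would be an eigenvalue [>= s] of [B], obtained by compactness from the
   normalized solutions of [t w^[m-1] = B w^(m-1) + 1] as [t] decreases to [c].
   Finally the majorization matrix [N] maps [w^[m-1]] to a positive vector, so
   it is invertible, and the [(m-1)]-st root of [N^-1 b] is a subsolution. *)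
Require Import Defs.
From mathcomp Require Import boolp topology normedtype derive realfun exp.
From mathcomp Require Import ring lra.
Import Order.TTheory GRing.Theory Num.Theory.
Import numFieldNormedType.Exports.

Set Implicit Arguments.
Unset Strict Implicit.
Unset Printing Implicit Defensive.
Local Open Scope ring_scope.
Local Open Scope classical_set_scope.

(** * Roots, monotonicity and homogeneity *)

Lemma nonneg_root_exists (R : realType) (k : nat) (c : R) :
  (0 < k)%N -> 0 <= c -> exists2 y : R, 0 <= y & y ^+ k = c.
Proof.
move=> k0 c0; exists (powR c k%:R^-1); first exact: powR_ge0.
rewrite -powR_mulrn ?powR_ge0// -powRrM mulVf ?powRr1//.
by rewrite pnatr_eq0 -lt0n.
Qed.

Lemma tensor_apply_homo (R : realType) (m n : nat) (B : tensor R m n)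
    (x y : 'cV[R]_n) :
  (forall t, 0 <= B t) -> vec_nonneg x -> vec_le x y ->
  vec_le (tensor_apply B x) (tensor_apply B y).
Proof.
move=> B0 x0 xy i; rewrite !mxE; apply: ler_sum => t _.
apply: ler_wpM2l => //; apply: ler_prod => j _.
by have := x0 j; rewrite mxE => ->; rewrite xy.
Qed.

Lemma tensor_apply_nonneg (R : realType) (m n : nat) (B : tensor R m n)
    (x : 'cV[R]_n) :
  (forall t, 0 <= B t) -> vec_nonneg x -> vec_nonneg (tensor_apply B x).
Proof.
move=> B0 x0 i; rewrite !mxE; apply: sumr_ge0 => t _.
apply: mulr_ge0 => //; apply: prodr_ge0 => j _.
by have := x0 j; rewrite mxE.
Qed.

Lemma tensor_applyZ (R : realType) (m n : nat) (B : tensor R m n) (c : R)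
    (x : 'cV[R]_n) :
  tensor_apply B (c *: x) = c ^+ m.-1 *: tensor_apply B x.
Proof.
apply/colP => i; rewrite !mxE mulr_sumr; apply: eq_bigr => t _.
rewrite mulrCA; congr (_ * _).
have <- : size (behead t) = m.-1 by rewrite size_behead size_tuple.
elim: (behead t) => [|j l IH]; first by rewrite !big_nil expr0 mul1r.
by rewrite !big_cons IH mxE /= exprS; ring.
Qed.

(** * The tensor [s I - B] and its majorization matrix *)

Definition shifted_tensor (R : realType) (m n : nat) (s : R)
  (B : tensor R m n) : tensor R m n := fun t => s * tensor_id R t - B t.

(** Among the index tuples with head [i], only the constant one meets the diagonal. *)
Lemma tensor_apply_shifted (R : realType) (m n : nat) (s : R)
    (B : tensor R m n) (x : 'cV[R]_n) (i : 'I_n) : (0 < m)%N ->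
  tensor_apply (shifted_tensor s B) x i 0 =
  s * x i 0 ^+ m.-1 - tensor_apply B x i 0.
Proof.
move=> m0; rewrite !mxE.
under eq_bigr do rewrite /shifted_tensor mulrBl.
rewrite big_split /= sumrN; congr (_ - _).
have hi : ohead (nseq_tuple m i) == Some i by case: (m) m0.
rewrite (bigD1 (nseq_tuple m i)) //= [X in _ + X]big1 ?addr0.
  rewrite /tensor_id constant_nseq mulr1; congr (_ * _).
  case: (m) => [|k] /=; first by rewrite big_nil expr0.
  by rewrite big_nseq; elim: k => //= k ->; rewrite exprS.
move=> t /andP[ht tn]; rewrite /tensor_id.
have [/(constantP i) [j tj]|_] := boolP (constant t); last first.
  by rewrite mulr0 mul0r.
move: ht tn; rewrite -val_eqE /= tj size_tuple.
by case: (m) m0 => //= k _ /eqP[->]; rewrite eqxx.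
Qed.

(** Repeats the tuple of [majorization_mx], so that the next lemma rewrites its entries. *)
Definition tail_constant_tuple (m n : nat) (i j : 'I_n) : m.-tuple 'I_n :=
  [tuple (if k == 0%N :> nat then i else j) | k < m].

Lemma tail_constant_tupleE (m n : nat) (i j : 'I_n) :
  tail_constant_tuple m.+1 i j = i :: nseq m j :> seq _.
Proof.
apply: (@eq_from_nth _ i) => [|k]; rewrite size_tuple /= ?size_nseq // => km.
rewrite -[k]/(val (Ordinal km)).
rewrite (_ : nth _ _ _ = tnth (tail_constant_tuple m.+1 i j) (Ordinal km)); last first.
  by rewrite (tnth_nth i).
rewrite tnth_mktuple /=; case: k km => //= k km.
by rewrite nth_nseq -ltnS km.
Qed.

Lemma majorization_shifted (R : realType) (m n : nat) (s : R)
    (B : tensor R m n) : (1 < m)%N ->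
  majorization_mx (shifted_tensor s B) = s%:M - majorization_mx B.
Proof.
case: m B => [|[|m]] // B _; apply/matrixP => i j; rewrite !mxE /shifted_tensor.
congr (_ - _); rewrite mulr_natr; congr (_ *+ _).
rewrite (tail_constant_tupleE m.+1 i j) /=.
by rewrite (eq_sym i j); case: eqP => //= ->; rewrite all_nseq /= eqxx orbT.
Qed.

(** The index tuples [(i, j, ..., j)] contribute exactly the left-hand side, and the remaining terms
    are nonnegative. *)
Lemma majorization_apply_le (R : realType) (m n : nat) (B : tensor R m n)
    (x : 'cV[R]_n) : (1 < m)%N -> (forall t, 0 <= B t) -> vec_nonneg x ->
  vec_le (majorization_mx B *m vec_pow m.-1 x) (tensor_apply B x).
Proof.
move=> m1 B0 x0 i; rewrite !mxE.
pose h (j : 'I_n) := tail_constant_tuple m i j.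
have hE j : h j = i :: nseq m.-1 j :> seq _.
  by rewrite /h; case: (m) m1 => // k _; rewrite tail_constant_tupleE.
(* Recovering [j] takes a second entry of the tuple, hence [1 < m]. *)
have hI : injective h.
  move=> j j' /(congr1 val) /=; rewrite !hE.
  by case: (m) m1 => [|[|k]] // _ [].
pose f t := B t * \prod_(j <- behead t) x j 0.
have f0 t : 0 <= f t.
  apply: mulr_ge0 => //; apply: prodr_ge0 => j _.
  by have := x0 j; rewrite mxE.
have -> : \sum_j majorization_mx B i j * vec_pow m.-1 x j 0 = \sum_j f (h j).
  apply: eq_bigr => j _; rewrite !mxE /f hE /= big_nseq; congr (_ * _).
  by elim: (m.-1) => //= k IH; rewrite exprS IH.
rewrite -(big_imset f (in2W hI)) /=.
rewrite [X in _ <= X](bigID [in [set h j | j in 'I_n]%SET]) /=.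
rewrite [X in _ <= X + _](eq_bigl [in [set h j | j in 'I_n]%SET]).
  by rewrite lerDl; apply: sumr_ge0 => t _; exact: f0.
move=> t /=; rewrite andbC; case: imsetP => //= -[j _ ->].
by rewrite hE /= eqxx.
Qed.

(** * Semipositivity and the largest subsolution *)

Lemma sub_solutions_shiftedP (R : realType) (m n : nat) (s : R)
    (B : tensor R m n) (b x : 'cV[R]_n) : (0 < m)%N ->
  sub_solutions (shifted_tensor s B) b x <->
  vec_nonneg x /\
  forall i, s * x i 0 ^+ m.-1 <= tensor_apply B x i 0 + b i 0.
Proof.
move=> m0; split=> -[x0 h]; split=> // i; have := h i;
  by rewrite tensor_apply_shifted // lerBlDl.
Qed.

(** That is, [s I - B] maps some positive vector to a positive vector, as a nonsingular M-matrix
    does. *)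
Definition semipositive (R : realType) (m n : nat) (s : R)
    (B : tensor R m n) : Prop :=
  exists2 w : 'cV[R]_n, vec_pos w &
    forall i, tensor_apply B w i 0 < s * w i 0 ^+ m.-1.

(* If [t] is least with [x <= t w], then at an index where equality holds
   the inequality for [x] bounds [t ^+ m.-1]. *)
Lemma sub_solutions_bounded (R : realType) (m n : nat) (s : R)
    (B : tensor R m n) (b : 'cV[R]_n) : (1 < m)%N ->
  (forall t, 0 <= B t) -> semipositive s B ->
  exists c : 'cV[R]_n, forall x, sub_solutions (shifted_tensor s B) b x ->
    vec_le x c.
Proof.
move=> m1 B0 [w w0 Bw]; have m0 := ltnW m1.
pose d i := s * w i 0 ^+ m.-1 - tensor_apply B w i 0.
have d0 i : 0 < d i by rewrite subr_gt0.
(* The sum bounds [t ^+ m.-1], hence [t] when [t > 1]; the summand 1 covers [t <= 1]. *)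
pose C := 1 + \sum_i `|b i 0| / d i.
exists (C *: w) => x /(sub_solutions_shiftedP _ _ _ _ m0)[x0 hx] i.
rewrite mxE -ler_pdivrMr //.
case: (arg_maxP (fun j => x j 0 / w j 0) (erefl true : predT i)) => k _ hk.
apply: (le_trans (hk i isT)); set t := x k 0 / w k 0.
have xk : x k 0 = t * w k 0 by rewrite divfK // gt_eqF.
have t0 : 0 <= t.
  by apply: divr_ge0; [have := x0 k; rewrite mxE | exact: ltW].
have xle : vec_le x (t *: w).
  by move=> j; rewrite mxE -ler_pdivrMr //; exact: hk.
have := tensor_apply_homo B0 x0 xle k.
rewrite tensor_applyZ [leRHS]mxE => Bx.
have := hx k; rewrite xk exprMn => hk'.
have tk : t ^+ m.-1 * d k <= b k 0 by rewrite /d; lra.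
have tC : t ^+ m.-1 <= \sum_i `|b i 0| / d i.
  apply: (@le_trans _ _ (`|b k 0| / d k)).
    by rewrite ler_pdivlMr // (le_trans tk) // ler_norm.
  rewrite (bigD1 k) //= lerDl sumr_ge0 // => j _.
  by rewrite divr_ge0 // ltW.
have [t1|/ltW t1] := leP t 1.
  by rewrite (le_trans t1) // lerDl sumr_ge0 // => j _; rewrite divr_ge0 // ltW.
apply: (@le_trans _ _ (t ^+ m.-1)); last by rewrite (le_trans tC) // lerDr.
by rewrite -[leLHS]expr1 ler_weXn2l // -ltnS prednK.
Qed.

(* The componentwise supremum is a solution: raising it to the [m.-1]-st root
   of [(B x + b) / s] gives another element of the set. *)
Lemma largest_sub_solution (R : realType) (m n : nat) (s : R)
    (B : tensor R m n) (b : 'cV[R]_n) : (1 < m)%N -> 0 < s ->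
  (forall t, 0 <= B t) -> semipositive s B ->
  sub_solutions (shifted_tensor s B) b !=set0 ->
  exists2 x, is_largest (sub_solutions (shifted_tensor s B) b) x &
    tensor_apply (shifted_tensor s B) x = b.
Proof.
move=> m1 s0 B0 sB [x1 Sx1]; have m0 := ltnW m1.
have k0 : (0 < m.-1)%N by rewrite -ltnS prednK.
set S := sub_solutions _ _ in Sx1 *.
have [c hc] := sub_solutions_bounded b m1 B0 sB.
pose x : 'cV[R]_n := \col_i sup [set y i 0 | y in S].
have ub y : S y -> vec_le y x.
  move=> Sy i; rewrite mxE; apply: ub_le_sup; last by exists y.
  by exists (c i 0) => _ [z Sz <-]; exact: hc.
have x0 : vec_nonneg x.
  move=> i; apply: le_trans (ub _ Sx1 i); exact: Sx1.1.
have hb i : 0 <= tensor_apply B x i 0 + b i 0 /\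
    s * x i 0 ^+ m.-1 <= tensor_apply B x i 0 + b i 0.
  have hy y : S y -> s * y i 0 ^+ m.-1 <= tensor_apply B x i 0 + b i 0.
    move=> Sy; have [y0 yB] := (sub_solutions_shiftedP _ _ _ _ m0).1 Sy.
    apply: (le_trans (yB i)); rewrite lerD2r.
    by apply: tensor_apply_homo => //; exact: ub.
  have e0 : 0 <= tensor_apply B x i 0 + b i 0.
    apply: le_trans (hy _ Sx1); apply: mulr_ge0 (ltW s0) _.
    by apply: exprn_ge0; have := Sx1.1 i; rewrite mxE.
  split=> //; rewrite -ler_pdivlMl //.
  have c0 : 0 <= s^-1 * (tensor_apply B x i 0 + b i 0).
    by apply: mulr_ge0 => //; rewrite invr_ge0 ltW.
  (* The bound on powers passes to the supremum through its root: [r] bounds the [i]-th coordinates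
     of [S], so [x i 0 <= r]. *)
  have [r r0 re] := nonneg_root_exists k0 c0.
  rewrite -re lerXn2r ?nnegrE //; first by have := x0 i; rewrite mxE.
  rewrite mxE; apply: ge_sup; first by exists (x1 i 0), x1.
  move=> _ [y Sy <-].
  have y0 : 0 <= y i 0 by have := Sy.1 i; rewrite mxE.
  by rewrite -(@ler_pXn2r _ m.-1) ?nnegrE // re ler_pdivlMl // hy.
have /choice[y hy] i : exists r, 0 <= r /\
    s * r ^+ m.-1 = tensor_apply B x i 0 + b i 0.
  have c0 : 0 <= s^-1 * (tensor_apply B x i 0 + b i 0).
    by apply: mulr_ge0 (hb i).1; rewrite invr_ge0 ltW.
  have [r r0 re] := nonneg_root_exists k0 c0; exists r; split=> //.
  by rewrite re mulrA mulfV ?mul1r // gt_eqF.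
pose z : 'cV[R]_n := \col_i y i.
have z0 : vec_nonneg z by move=> i; rewrite !mxE; exact: (hy i).1.
have xz : vec_le x z.
  move=> i; rewrite -(@ler_pXn2r _ m.-1) ?nnegrE //.
  - by rewrite -(ler_pM2l s0) [z i 0]mxE (hy i).2; exact: (hb i).2.
  - by have := x0 i; rewrite mxE.
  - by have := z0 i; rewrite mxE.
have Sz : S z.
  apply/sub_solutions_shiftedP => //; split=> // i.
  rewrite [z i 0]mxE (hy i).2 lerD2r.
  exact: tensor_apply_homo.
have zx : z = x.
  by apply/colP => i; apply/eqP; rewrite eq_le xz andbT; exact: ub.
exists x; first by split=> //; rewrite -zx.
apply/colP => i; rewrite tensor_apply_shifted //.
rewrite -[in s * _]zx [z i 0]mxE (hy i).2; ring.
Qed.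

(** * Compactness, eigenvectors and the spectral radius *)

Lemma continuous_tensor_apply (R : realType) (m n : nat) (B : tensor R m n)
    (i : 'I_n) :
  continuous (fun r : 'rV[R]_n => tensor_apply B r^T i 0).
Proof.
have -> : (fun r : 'rV[R]_n => tensor_apply B r^T i 0) =
    fun r => \sum_(t : m.-tuple 'I_n | ohead t == Some i)
      B t * \prod_(j <- behead t) r 0 j.
  apply/funext => r; rewrite mxE; apply: eq_bigr => t _; congr (_ * _).
  by apply: eq_bigr => j _; rewrite mxE.
apply: continuous_big => [|t _]; first exact: add_continuous.
move=> r; apply: continuousM; first exact: cst_continuous.
apply: continuous_big => [|j _]; first exact: mul_continuous.
exact: coord_continuous.
Qed.

(** The total defect [g] is continuous and attains its minimum on the unit cube, where all the
    approximations lie; so this minimum is 0. The term for the sum keeps the minimizer away from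
    0. *)
Lemma approximate_eigenvector (R : realType) (m n : nat) (B : tensor R m n)
    (s : R) :
  (forall e : R, 0 < e -> exists x : 'cV[R]_n,
    [/\ vec_nonneg x, \sum_i x i 0 = 1 &
        forall i, `|s * x i 0 ^+ m.-1 - tensor_apply B x i 0| <= e]) ->
  exists x : 'cV[R]_n, [/\ vec_nonneg x, x != 0 &
    tensor_apply B x = s *: vec_pow m.-1 x].
Proof.
move=> H.
pose g (r : 'rV[R]_n) := `|\sum_i r 0 i - 1| +
  \sum_i `|s * r 0 i ^+ m.-1 - tensor_apply B r^T i 0|.
have cg : continuous g.
  have cN (h : 'rV[R]_n -> R) : continuous h -> continuous (fun r => `|h r|).
    move=> ch r; apply: (@continuous_comp _ _ _ h Num.norm); first exact: ch.
    exact: norm_continuous.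
  have cD (h1 h2 : 'rV[R]_n -> R) : continuous h1 -> continuous h2 ->
      continuous (fun r => h1 r + h2 r).
    by move=> c1 c2 r; apply: continuousD; [exact: c1|exact: c2].
  have cB (h1 h2 : 'rV[R]_n -> R) : continuous h1 -> continuous h2 ->
      continuous (fun r => h1 r - h2 r).
    by move=> c1 c2 r; apply: continuousB; [exact: c1|exact: c2].
  apply: cD.
    apply/cN/cB; last exact: cst_continuous.
    apply: continuous_big => [|j _]; first exact: add_continuous.
    exact: coord_continuous.
  apply: continuous_big => [|i _]; first exact: add_continuous.
  apply/cN/cB => [r|]; last exact: continuous_tensor_apply.
  apply: (@continuousM _ _ (fun=> s) (fun r : 'rV[R]_n => r 0 i ^+ m.-1)).
    exact: cst_continuous.
  apply: (@continuous_comp _ _ _ (fun r : 'rV[R]_n => r 0 i)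
    (fun y => y ^+ m.-1)); first exact: coord_continuous.
  exact: exprn_continuous.
pose A := [set r : 'rV[R]_n | forall i, `[0, 1]%classic (r ord0 i)].
have cA : compact A.
  exact: (@rV_compact R n (fun=> `[0, 1]%classic) (fun=> @segment_compact R 0 1)).
have A0 : A !=set0.
  by exists 0 => i; rewrite mxE /= in_itv /= lexx ler01.
have [r rA rmin] := EVT_min_rV A0 cA (continuous_subspaceT cg).
have small e : 0 < e -> g r <= e.
  (* The [n] errors must add up to at most [e]; [n.+1] is a divisor that is never zero. *)
  move=> e0; have n0 : 0 < n.+1%:R :> R by rewrite ltr0n.
  have [x [x0 x1 xe]] := H _ (divr_gt0 e0 n0).
  have xT : x^T \in A.
    rewrite inE => i; rewrite mxE /= in_itv /=.
    have x0' j : 0 <= x j 0 by have := x0 j; rewrite mxE.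
    by rewrite x0' -x1 (bigD1 i) //= lerDl sumr_ge0.
  apply: (le_trans (rmin _ xT)); rewrite /g trmxK.
  under eq_bigr do rewrite mxE.
  rewrite x1 subrr normr0 add0r.
  apply: (@le_trans _ _ (\sum_(i < n) e / n.+1%:R)).
    by apply: ler_sum => i _; rewrite [x^T _ _]mxE xe.
  rewrite sumr_const card_ord -[_ *+ n]mulr_natr mulrAC ler_pdivrMr // ler_pM2l //.
  by rewrite ler_nat.
have g0 : g r = 0.
  apply/eqP; rewrite eq_le; apply/andP; split; last first.
    by rewrite addr_ge0 // sumr_ge0.
  by apply/ler_addgt0Pr => e e0; rewrite add0r small.
move/eqP: g0; rewrite paddr_eq0 ?sumr_ge0 //.
rewrite normr_eq0 subr_eq0 psumr_eq0 // => /andP[/eqP r1 /allP rB].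
exists r^T; split.
- move=> i; rewrite !mxE; move: rA; rewrite inE => /(_ i) /=.
  by rewrite in_itv /= => /andP[].
- apply/eqP => /(congr1 trmx); rewrite trmxK trmx0 => r0.
  move: r1; rewrite r0 big1 => [/esym/eqP|j _]; last by rewrite mxE.
  by rewrite oner_eq0.
- apply/colP => i; have := rB i (mem_index_enum _).
  rewrite normr_eq0 subr_eq0 => /eqP <-.
  by rewrite !mxE.
Qed.

Lemma real_eigenvalue (R : realType) (m n : nat) (B : tensor R m n) (s : R)
    (x : 'cV[R]_n) :
  x != 0 -> tensor_apply B x = s *: vec_pow m.-1 x ->
  tensor_eigenvalue B (s%:C)%C.
Proof.
move=> x0 Bx; exists (map_mx (real_complex R) x).
  by rewrite map_mx_eq0.
apply/colP => i; have /matrixP/(_ i 0)/(congr1 (real_complex R)) := Bx.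
rewrite !mxE rmorphM rmorphXn rmorph_sum /= => <-.
apply: eq_bigr => t _; rewrite rmorphM rmorph_prod /=; congr (_ * _).
by apply: eq_bigr => j _; rewrite mxE.
Qed.

(* [c] is the infimum of the [t > 0] with [semipositive t B].  If [s <= c],
   then for [t] slightly above [c] the solution of [t w^(m-1) = B w^(m-1) + 1],
   divided by its sum, is an approximate eigenvector of [B] for [c]; by
   compactness [c] is an eigenvalue. *)
Lemma semipositive_spectral (R : realType) (m n : nat) (B : tensor R m n)
    (s r : R) : (1 < m)%N -> 0 < s -> (forall t, 0 <= B t) ->
  is_spectral_radius B r -> r < s -> semipositive s B.
Proof.
move=> m1 s0 B0 [_ hr] rs; have m0 := ltnW m1.
have k0 : (0 < m.-1)%N by rewrite -ltnS prednK.
pose G := [set t : R | 0 < t /\ semipositive t B].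
have Gup t t' : t <= t' -> G t -> G t'.
  move=> tt' [t0 [w w0 hw]]; split; first exact: lt_le_trans tt'.
  exists w => // i; apply: lt_le_trans (hw i) _.
  by rewrite ler_wpM2r // exprn_ge0 // ltW.
have G0 : G !=set0.
  (* For the all-ones vector the condition on [t] is that it exceed each entry of [u]. *)
  pose u := tensor_apply B (const_mx 1).
  have u0 i : 0 <= u i 0.
    have c0 : vec_nonneg (const_mx 1 : 'cV[R]_n) by move=> j; rewrite !mxE.
    by have := tensor_apply_nonneg B0 c0 i; rewrite mxE.
  exists (1 + \sum_i u i 0); split.
    by rewrite ltr_wpDr // sumr_ge0.
  exists (const_mx 1) => i; first by rewrite mxE.
  rewrite -/u [const_mx 1 i 0]mxE expr1n mulr1 (bigD1 i) //=.
  by rewrite addrCA ltrDl ltr_wpDr // sumr_ge0.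
have Glb : has_lbound G by exists 0 => t [/ltW].
pose c := inf G.
have Ggt t : c < t -> G t.
  move=> ct; have d0 : 0 < t - c by rewrite subr_gt0.
  have [g Gg] := inf_adherent d0 (conj G0 Glb).
  by rewrite -/c addrC subrK => /ltW /Gup; exact.
have [/Ggt[]//|sc] := ltP c s.
have c0 : 0 < c := lt_le_trans s0 sc.
(* Finitely many strict inequalities survive a small decrease of [c], against the choice of [c] as
   infimum. *)
have nG : ~ semipositive c B.
  move=> [w w0 hw].
  have [e e0 he] : exists2 e, 0 < e & forall i,
      e * w i 0 ^+ m.-1 < c * w i 0 ^+ m.-1 - tensor_apply B w i 0.
    pose d i := (c * w i 0 ^+ m.-1 - tensor_apply B w i 0) / w i 0 ^+ m.-1.
    have d0 i : 0 < d i by rewrite divr_gt0 ?exprn_gt0 // subr_gt0.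
    (* [D] exceeds each [(d i)^-1], so [D^-1] is below each [d i]. *)
    pose D := 1 + \sum_i (d i)^-1.
    have D0 : 0 < D by rewrite ltr_wpDr // sumr_ge0 // => i _; rewrite invr_ge0 ltW.
    exists D^-1; first by rewrite invr_gt0.
    move=> i; rewrite -ltr_pdivlMr ?exprn_gt0 // -/(d i).
    rewrite invf_plt ?posrE // /D (bigD1 i) //= addrCA ltrDl.
    by rewrite ltr_wpDr // sumr_ge0 // => j _; rewrite invr_ge0 ltW.
  (* The term [c / 2] keeps [t] positive, as [G] demands. *)
  pose t := Num.max (c - e) (c / 2).
  have tc : t < c by rewrite /t gt_max; apply/andP; split; lra.
  have : G t.
    split; first by rewrite lt_max; apply/orP; right; lra.
    exists w => // i; have := he i.
    have : (c - e) * w i 0 ^+ m.-1 <= t * w i 0 ^+ m.-1.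
      by rewrite ler_wpM2r ?exprn_ge0 ?(ltW (w0 i)) // le_max lexx.
    by lra.
  by move/(ge_inf Glb); rewrite -/c leNgt tc.
have [|x [x0 xn0 Bx]] := @approximate_eigenvector R m n B c.
  move=> e e0; pose t := c + e / 2.
  have ct : c < t by rewrite /t; lra.
  have t0 : 0 < t := lt_trans c0 ct.
  have [_ tB] := Ggt _ ct.
  have [|w [[w0 _] _] wt] := largest_sub_solution (b := const_mx 1) m1 t0 B0 tB.
    exists 0; apply/sub_solutions_shiftedP => //; split => [i|i]; first exact: lexx.
    have z0 : vec_nonneg (0 : 'cV[R]_n) by move=> j; exact: lexx.
    have := tensor_apply_nonneg B0 z0 i; rewrite [leLHS]mxE => Bz.
    by rewrite [X in X ^+ _]mxE expr0n gtn_eqF // mulr0 [const_mx 1 i 0]mxE addr_ge0.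
  have w0' i : 0 <= w i 0 by have := w0 i; rewrite mxE.
  have wE i : tensor_apply B w i 0 = t * w i 0 ^+ m.-1 - 1.
    have /matrixP/(_ i 0) := wt; rewrite tensor_apply_shifted // [RHS]mxE => h.
    by rewrite -h; ring.
  (* Otherwise [w] would witness semipositivity at [c]: a zero entry of [w] would make [B w] equal
     to -1 there. At this [i], [w i 0 ^+ m.-1] is at least [2 / e], so [w] blows up as [t] tends to
     [c]. *)
  have [i hi] : exists i, c * w i 0 ^+ m.-1 <= tensor_apply B w i 0.
    apply: contrapT => /forallNP h; apply: nG; exists w => i.
      rewrite lt_neqAle w0' andbT; apply/eqP => wi.
      have := tensor_apply_nonneg B0 w0 i.
      by rewrite [leLHS]mxE wE -wi expr0n gtn_eqF // mulr0; lra.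
    by rewrite ltNge; apply/negP/h.
  pose S := \sum_j w j 0.
  have wS j : w j 0 <= S by rewrite /S (bigD1 j) //= lerDl sumr_ge0.
  have wi1 : 1 <= e / 2 * w i 0 ^+ m.-1.
    by move: hi; rewrite wE /t; lra.
  have S0 : 0 < S.
    apply: lt_le_trans (wS i); rewrite lt_neqAle w0' andbT; apply/eqP => wi.
    by move: wi1; rewrite -wi expr0n gtn_eqF // mulr0; lra.
  have Sk : (S ^+ m.-1)^-1 <= e / 2.
    rewrite invf_ple ?posrE ?exprn_gt0 //; last lra.
    apply: le_trans (_ : _ <= w i 0 ^+ m.-1) _.
      by rewrite -div1r ler_pdivrMr; [rewrite mulrC|lra].
    by rewrite lerXn2r ?nnegrE // ltW.
  exists (S^-1 *: w); split.
  - by move=> j; rewrite !mxE mulr_ge0 // invr_ge0 ltW.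
  - under eq_bigr do rewrite mxE.
    by rewrite -mulr_sumr mulVf // gt_eqF.
  - move=> j; rewrite tensor_applyZ [(S^-1 *: w) j 0]mxE.
    rewrite [(_ *: tensor_apply _ _) j 0]mxE wE exprMn.
    set p := S^-1 ^+ m.-1; set q := w j 0 ^+ m.-1.
    have p0 : 0 <= p by rewrite exprn_ge0 // invr_ge0 ltW.
    have pe : p <= e / 2 by rewrite /p exprVn.
    have q0 : 0 <= q by rewrite exprn_ge0.
    have pq : p * q <= 1.
      rewrite -exprMn exprn_ile1 ?mulr_ge0 ?invr_ge0 ?(ltW S0) //.
      by rewrite mulrC ler_pdivrMr // mul1r.
    (* Both terms lie between 0 and [e / 2], so their difference is at most [e / 2] in modulus. *)
    rewrite (_ : _ - _ = p - (e / 2) * (p * q)); last by rewrite /t; ring.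
    have e20 : 0 <= e / 2 by lra.
    have := mulr_ge0 e20 (mulr_ge0 p0 q0); have := ler_wpM2l e20 pq.
    by rewrite ler_norml; lra.
(* The eigenvalue [c] gives [s <= c <= r], against [r < s]. *)
have := hr _ (real_eigenvalue xn0 Bx).
rewrite normc_def /= expr0n addr0 sqrtr_sqr lecE /= eqxx /=.
by rewrite ger0_norm ?(ltW c0) // => /(le_trans sc); rewrite leNgt rs.
Qed.

(** * Subsolutions from the majorization matrix *)

(* [v = w^(m-1)] satisfies [v > 0] and [N v > 0] for the majorization matrix
   [N]; if [N u = 0], compare [u] with [v] where [|u_i| / v_i] is maximal. *)
Lemma majorization_shifted_unitmx (R : realType) (m n : nat) (s : R)
    (B : tensor R m n) : (1 < m)%N ->
  (forall t, 0 <= B t) -> semipositive s B ->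
  majorization_mx (shifted_tensor s B) \in unitmx.
Proof.
move=> m1 B0 [w w0 hw]; rewrite majorization_shifted //.
set A := majorization_mx B.
have A0 i j : 0 <= A i j by rewrite mxE.
have wn : vec_nonneg w by move=> i; rewrite mxE ltW.
pose v := vec_pow m.-1 w.
have v0 i : 0 < v i 0 by rewrite mxE exprn_gt0.
have hv i : \sum_j A i j * v j 0 < s * v i 0.
  have := majorization_apply_le m1 B0 wn i; rewrite [leLHS]mxE => h.
  by apply: le_lt_trans h _; rewrite [v i 0]mxE.
(* A row vector in the left kernel of the transpose is a column vector in the right kernel of
   [s%:M - A]. *)
rewrite -unitmx_tr -row_free_unit -kermx_eq0; apply/rowV0P => u /sub_kermxP.
move/(congr1 trmx); rewrite trmx_mul trmxK trmx0 mulmxBl mul_scalar_mx.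
move=> /eqP; rewrite subr_eq0 => /eqP hu; apply/rowP => i; rewrite mxE.
case: (arg_maxP (fun j => `|u 0 j| / v j 0) (erefl true : predT i)) => k _ hk.
set q := `|u 0 k| / v k 0 in hk.
have uq j : `|u 0 j| <= q * v j 0 by rewrite -ler_pdivrMr //; exact: hk.
have uk : `|u 0 k| = q * v k 0 by rewrite divfK // gt_eqF.
have q0 : 0 <= q by rewrite divr_ge0 // ltW.
have s0 : 0 < s.
  rewrite -(pmulr_lgt0 _ (v0 k)); apply: le_lt_trans (hv k).
  by apply: sumr_ge0 => j _; rewrite mulr_ge0 // ltW.
have le1 : s * (q * v k 0) <= q * \sum_j A k j * v j 0.
  have e : s * u 0 k = \sum_j A k j * u^T j 0.
    by have /matrixP/(_ k 0) := hu; rewrite [LHS]mxE [u^T k 0]mxE [RHS]mxE.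
  rewrite -uk -(gtr0_norm s0) -normrM e mulr_sumr.
  apply: le_trans (ler_norm_sum _ _ _) _; apply: ler_sum => j _.
  by rewrite [u^T j 0]mxE normrM ger0_norm // mulrCA ler_wpM2l.
have q00 : q = 0.
  apply/eqP; rewrite eq_le q0 andbT leNgt; apply/negP => qp.
  have := hv k; rewrite -(ltr_pM2l qp); lra.
by apply/eqP; rewrite -normr_le0 (le_trans (uq i)) // q00 mul0r.
Qed.

(** With [A] the majorization matrix of [B] and [x] the entrywise root of [y], [s y = A y + b] and
    [A y <= B x^(m-1)]. The equation kept for [x] later transfers positivity from [y] to [x]. *)
Lemma majorization_sub_solution (R : realType) (m n : nat) (s : R)
    (B : tensor R m n) (b : 'cV[R]_n) : (1 < m)%N ->
  (forall t, 0 <= B t) -> semipositive s B ->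
  let y := invmx (majorization_mx (shifted_tensor s B)) *m b in
  vec_nonneg y -> exists2 x, sub_solutions (shifted_tensor s B) b x &
    vec_pow m.-1 x = y.
Proof.
move=> m1 B0 sB y y0; have m0 := ltnW m1.
have k0 : (0 < m.-1)%N by rewrite -ltnS prednK.
have Ny : majorization_mx (shifted_tensor s B) *m y = b.
  by rewrite /y mulKVmx // majorization_shifted_unitmx.
have /choice[x hx] i : exists r, 0 <= r /\ r ^+ m.-1 = y i 0.
  have [|r r0 re] := @nonneg_root_exists R _ (y i 0) k0; last by exists r.
  by have := y0 i; rewrite mxE.
exists (\col_i x i); last by apply/colP => i; rewrite [LHS]mxE [X in X ^+ _]mxE (hx i).2.
have x0 : vec_nonneg (\col_i x i) by move=> i; rewrite !mxE (hx i).1.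
apply/sub_solutions_shiftedP => //; split=> // i.
have := majorization_apply_le m1 B0 x0 i.
have -> : vec_pow m.-1 (\col_i x i) = y.
  by apply/colP => j; rewrite [LHS]mxE [X in X ^+ _]mxE (hx j).2.
move: Ny; rewrite majorization_shifted // mulmxBl mul_scalar_mx.
move=> /matrixP/(_ i 0); rewrite [LHS]mxE [X in X + _]mxE [X in _ + X]mxE.
by rewrite [X in X ^+ _]mxE (hx i).2; lra.
Qed.

Theorem theorem2p4 (R : realType) (m n : nat) (hm : (2 <= m)%N) (hn : (1 <= n)%N)
    (M : tensor R m n) (hM : strong_M_tensor M) (b : 'cV[R]_n) :
  [/\ nonneg_solutions M b !=set0 <-> sub_solutions M b !=set0,
      sub_solutions M b !=set0 ->
        exists xbar : 'cV[R]_n, is_largest (sub_solutions M b) xbar /\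
          is_largest (nonneg_solutions M b) xbar &
      vec_nonneg (invmx (majorization_mx M) *m b) ->
        nonneg_solutions M b !=set0]
  /\
  (pos_solutions M b !=set0 <->
     (exists2 x : 'cV[R]_n, sub_solutions M b x & vec_pos x)) /\
  (vec_pos (invmx (majorization_mx M) *m b) -> pos_solutions M b !=set0).
Proof.
have [s [B [r [s0 B0 MB hr rs]]]] := hM.
have sB := semipositive_spectral hm s0 B0 hr rs.
have {MB hM} -> : M = shifted_tensor s B by apply/funext.
set M' := shifted_tensor s B.
have subS x : tensor_apply M' x = b -> vec_le (tensor_apply M' x) b.
  by move=> -> i.
have largest := largest_sub_solution (b := b) hm s0 B0 sB.
have solve : sub_solutions M' b !=set0 -> nonneg_solutions M' b !=set0.
  by move=> /largest[x [[x0 _] _] Mx]; exists x.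
(* The largest subsolution is a solution and dominates the given positive one. *)
have solve_pos : (exists2 x, sub_solutions M' b x & vec_pos x) ->
    pos_solutions M' b !=set0.
  move=> [x Sx x0]; have [|z [_ zmax] Mz] := largest; first by exists x.
  by exists z; split=> // i; exact: lt_le_trans (zmax _ Sx i).
have k0 : (0 < m.-1)%N by rewrite -ltnS prednK // ltnW.
split; [split => //|split].
- by split=> // -[x [x0 /subS Mx]]; exists x.
- move=> /largest[x [Sx xmax] Mx]; exists x; split=> //.
  by split=> [|y [y0 /subS My]]; [split=> //; exact: Sx.1|exact: xmax].
- by move=> /(majorization_sub_solution hm B0 sB)[x Sx _]; apply: solve; exists x.
- split=> // -[x [x0 /subS Mx]]; exists x => //; split=> // i.
  by rewrite mxE ltW.
- move=> y0; apply: solve_pos.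
  have [|x Sx xy] := @majorization_sub_solution _ _ _ _ _ b hm B0 sB.
    by move=> i; rewrite mxE ltW.
  exists x => // i; have := y0 i; rewrite -xy mxE.
  have xi : 0 <= x i 0 by have := Sx.1 i; rewrite mxE.
  (* Since [m.-1] is positive, a zero entry of [x] would be a zero entry of [y]. *)
  by rewrite [0 < x i 0]lt0r xi andbT; apply: contraTneq => ->; rewrite expr0n gtn_eqF ?ltxx.
Qed.
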